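(* Let $e^{-f_t}$ and $e^{-g_t}$ be log-concave probability densities on $\mathbb R^{n_x}$ and $\mathbb R^{n_z}$ respectively, for $t=0,\dots,T$, let $F_0,\dots,F_{T-1}$ be real $n_x\times n_x$ matrices, $H_0,\dots,H_T$ real $n_z\times n_x$ matrices, and $z_0,\dots,z_T\in\mathbb R^{n_z}$. Consider the estimation problem $$(\mathcal P)\quad \min_{x_0,\dots,x_T}\ \sum_{t=0}^T f_t(w_t)+\sum_{t=0}^T g_t(z_t-H_tx_t)\quad\text{s.t. } x_{t+1}=F_tx_t+w_{t+1}\ (t=0,\dots,T-1),\ \ x_0=w_0,$$ and the control problem $$(\mathcal D)\quad \sup_{u_0,\dots,u_T}\ \sum_{t=0}^T\big(z_t'u_t-f_t^*(y_t)-g_t^*(u_t)\big)\quad\text{s.t. } y_t=F_t'y_{t+1}+H_t'u_t\ (t=0,\dots,T-1),\ \ y_T=H_T'u_T .$$ Assume that $(\mathcal P)$ is strictly feasible: there exist $x=(x_0,\dots,x_T)$ and $w=(w_0,\dots,w_T)$ satisfying $x_0=w_0$ and $x_{t+1}=F_tx_t+w_{t+1}$ for $t=0,\dots,T-1$, with $w\in\mathrm{int}(\mathrm{dom}(f))$ and $z-Hx\in\mathrm{int}(\mathrm{dom}(g))$. Then strong duality holds between $(\mathcal P)$ and $(\mathcal D)$: the supremum in $(\mathcal D)$ equals the optimal value of $(\mathcal P)$. Furthermore, the supremum in $(\mathcal D)$ is attained.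
   Context: Prime denotes transpose; $h^*(y)=\sup_x\{\langle x,y\rangle-h(x)\}$ is the convex conjugate; the domain of an extended-real-valued convex function is the set where it is finite. A log-concave density has the form $e^{-f}$ with $f$ convex with values in $(-\infty,\infty]$ and $e^{-\infty}=0$; by convention each $f_t$ and $g_t$ is taken to be its lower semicontinuous version (this changes the density only on a null set). Notation: $f(w)=\sum_{t=0}^Tf_t(w_t)$ for $w\in\mathbb R^{(T+1)n_x}$, $g(v)=\sum_{t=0}^Tg_t(v_t)$ for $v\in\mathbb R^{(T+1)n_z}$, $z=(z_0,\dots,z_T)$, $Hx=(H_0x_0,\dots,H_Tx_T)$. In $(\mathcal P)$, $w_0,\dots,w_T$ are determined by $x_0,\dots,x_T$ through the constraints; in $(\mathcal D)$, $y_0,\dots,y_T\in\mathbb R^{n_x}$ are determined by $u_0,\dots,u_T\in\mathbb R^{n_z}$ through the constraints. The optimal value of $(\mathcal P)$ is the infimum of its objective over its constraint set. *)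

(* Defs.v *)
From HB Require Import structures.
From mathcomp Require Import all_boot all_order all_algebra.
From mathcomp Require Import all_classical all_reals all_analysis.
From mathcomp Require Import measurable_realfun.
Set Implicit Arguments.
Unset Strict Implicit.
Unset Printing Implicit Defensive.
Import Order.TTheory GRing.Theory Num.Theory.
Import numFieldNormedType.Exports.
Local Open Scope classical_set_scope.
Local Open Scope ring_scope.
Local Open Scope ereal_scope.

Section lebesgue_cons.
Variables (R : realType) (n : nat).
Local Notation RT := (measurableTypeR R).
Variable m : {sigma_finite_measure set (n.-tuple RT) -> \bar R}.

Definition tuple_cons (p : RT * n.-tuple RT) : n.+1.-tuple RT :=
  [the n.+1.-tuple RT of p.1 :: p.2].

Definition tuple_uncons (v : n.+1.-tuple RT) : RT * n.-tuple RT :=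
  (thead v, [tuple of behead v]).

Lemma measurable_tuple_cons : measurable_fun setT tuple_cons.
Proof. exact: measurable_cons. Qed.

Lemma measurable_tuple_uncons : measurable_fun setT tuple_uncons.
Proof.
apply/measurable_fun_pairP; split; first exact: measurable_tnth.
exact: measurable_behead.
Qed.

Lemma tuple_consK : cancel tuple_cons tuple_uncons.
Proof. by case=> a v; congr pair; apply: val_inj. Qed.

Definition lebesgue_cons : set (n.+1.-tuple RT) -> \bar R :=
  pushforward (@lebesgue_measure R \x m) tuple_cons.

Let lebesgue_cons0 : lebesgue_cons set0 = 0.
Proof. by rewrite /lebesgue_cons /pushforward preimage_set0 measure0. Qed.

Let lebesgue_cons_ge0 A : 0 <= lebesgue_cons A.
Proof. by rewrite /lebesgue_cons /pushforward; exact: measure_ge0. Qed.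

Let lebesgue_cons_sigma_additive : semi_sigma_additive lebesgue_cons.
Proof.
move=> A mA tA mUA; rewrite /lebesgue_cons /pushforward preimage_bigcup.
have mpre B : measurable B -> measurable (tuple_cons @^-1` B).
  by move=> mB; rewrite -[X in measurable X]setTI; exact: measurable_tuple_cons.
apply: measure_semi_sigma_additive.
- by move=> i; exact: mpre.
- apply/trivIsetP => /= i j _ _ ij; rewrite -preimage_setI.
  by move/trivIsetP : tA => /(_ _ _ _ _ ij) ->//; rewrite preimage_set0.
- by rewrite -preimage_bigcup; exact: mpre.
Qed.

HB.instance Definition _ := isMeasure.Build _ _ _ lebesgue_cons
  lebesgue_cons0 lebesgue_cons_ge0 lebesgue_cons_sigma_additive.

Let lebesgue_cons_sigma_finite : sigma_finite setT lebesgue_cons.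
Proof.
have /sigma_finiteP[A [TA ndA Aoo]] := sigma_finiteT (@lebesgue_measure R).
have /sigma_finiteP[B [TB ndB Boo]] := sigma_finiteT m.
exists (fun i => tuple_uncons @^-1` (A i `*` B i)).
  rewrite -preimage_bigcup (_ : \bigcup_i _ = setT) ?preimage_setT//.
  rewrite -setXTT TA TB predeqE => -[x y]; split=> [[i _ []/= ? ?]|].
    by split; exists i.
  move=> [/= [i _ Aix] [k _ Bky]]; exists (maxn i k) => //; split.
  - by move: x Aix; exact/subsetPset/ndA/leq_maxl.
  - by move: y Bky; exact/subsetPset/ndB/leq_maxr.
move=> i; have [mA Ai] := Aoo i; have [mB Bi] := Boo i; split.
  rewrite -[X in measurable X]setTI; apply: measurable_tuple_uncons => //.
  exact: measurableX.
rewrite /lebesgue_cons /pushforward -comp_preimage.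
rewrite (_ : tuple_uncons \o tuple_cons = id); last first.
  by apply/funext => x; exact: tuple_consK.
by rewrite preimage_id product_measure1E// lte_mul_pinfty// ge0_fin_numE.
Qed.

HB.instance Definition _ := Measure_isSigmaFinite.Build _ _ _ lebesgue_cons
  lebesgue_cons_sigma_finite.

End lebesgue_cons.

(* The n-dimensional Lebesgue measure, on tuples with the product sigma-algebra:
   the library only has it in dimension 1. In dimension 0 it is the unit mass. *)
Fixpoint lebesgue_tuple (R : realType) (n : nat) :
    {sigma_finite_measure set (n.-tuple (measurableTypeR R)) -> \bar R} :=
  match n with
  | 0 => \d_ [tuple]
  | n'.+1 => lebesgue_cons (lebesgue_tuple R n')
  end.

Lemma lebesgue_tuple_box (R : realType) (n : nat)
    (A : 'I_n -> set (measurableTypeR R)) : (forall i, measurable (A i)) ->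
  lebesgue_tuple R n [set v | forall i, A i (tnth v i)] =
  \prod_(i < n) lebesgue_measure (A i).
Proof.
elim: n A => [|n IH] A mA.
  by rewrite big_ord0 /= diracE mem_set//= => -[].
rewrite big_ord_recl -IH// -product_measure1E//; last first.
  rewrite (_ : [set v | _] = \big[setI/setT]_(i < n)
      ((fun v : n.-tuple (measurableTypeR R) => tnth v i) @^-1` A (lift ord0 i))).
    apply: bigsetI_measurable => i _; rewrite -[X in measurable X]setTI.
    exact: measurable_tnth.
  rewrite -bigcap_seq; apply/seteqP; split => v /= vA i //=.
  by apply: vA; rewrite /= mem_index_enum.
rewrite /= /lebesgue_cons /pushforward; congr (_ _).
apply/seteqP; split => -[a v] /= vA.
  split; first exact: (vA ord0).
  by move=> i; have := vA (lift ord0 i); rewrite tnthS.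
case: vA => aA vA i; case: (unliftP ord0 i) => [j ->|->] //.
by rewrite tnthS.
Qed.

Section logconcave_density.
Variables (R : realType) (n : nat).

Definition is_probability_density (p : 'cV[R]_n -> \bar R) :=
  [/\ measurable_fun [set: n.-tuple (measurableTypeR R)]
        (fun v => p (\col_i tnth v i)%R),
      forall x, 0 <= p x &
      \int[lebesgue_tuple R n]_v p (\col_i tnth v i)%R = 1].

Definition ereal_convex (h : 'cV[R]_n -> \bar R) :=
  forall (x y : 'cV[R]_n) (a : R), (0 < a < 1)%R ->
    h (a *: x + (1 - a) *: y)%R <= a%:E * h x + (1 - a)%:E * h y.

Definition logconcave_density_potential (h : 'cV[R]_n -> \bar R) :=
  [/\ forall x, -oo < h x,
      ereal_convex h,
      lower_semicontinuous h &
      is_probability_density (fun x => expeR (- h x))].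

Definition dotv (x y : 'cV[R]_n) : R := (x^T *m y)%R 0%R 0%R.

Definition conjugate (h : 'cV[R]_n -> \bar R) (y : 'cV[R]_n) : \bar R :=
  ereal_sup [set (dotv x y)%:E - h x | x in [set: 'cV[R]_n]].

End logconcave_density.

Definition ereal_dom (V : Type) (R : realType) (h : V -> \bar R) : set V :=
  [set x | h x \is a fin_num].

Section problems.
Variables (R : realType) (nx nz T : nat).
Variables (f : 'I_T.+1 -> 'cV[R]_nx -> \bar R)
          (g : 'I_T.+1 -> 'cV[R]_nz -> \bar R)
          (F : 'I_T -> 'M[R]_nx) (H : 'I_T.+1 -> 'M[R]_(nz, nx))
          (z : 'I_T.+1 -> 'cV[R]_nz).

(* For t < T, the times t and t + 1 as elements of {0, ..., T}. *)
Definition tcur (t : 'I_T) : 'I_T.+1 := widen_ord (leqnSn T) t.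
Definition tnext (t : 'I_T) : 'I_T.+1 := lift ord0 t.

Definition primal_constraints (x w : 'I_T.+1 -> 'cV[R]_nx) :=
  x ord0 = w ord0 /\
  forall t : 'I_T, x (tnext t) = (F t *m x (tcur t) + w (tnext t))%R.

Definition primal_objective (x w : 'I_T.+1 -> 'cV[R]_nx) : \bar R :=
  \sum_(t < T.+1) f t (w t) + \sum_(t < T.+1) g t (z t - H t *m x t)%R.

Definition primal_value : \bar R :=
  ereal_inf [set a | exists x w, primal_constraints x w /\
                                 a = primal_objective x w].

Definition dual_constraints (u : 'I_T.+1 -> 'cV[R]_nz)
    (y : 'I_T.+1 -> 'cV[R]_nx) :=
  y ord_max = ((H ord_max)^T *m u ord_max)%R /\
  forall t : 'I_T,
    y (tcur t) = ((F t)^T *m y (tnext t) + (H (tcur t))^T *m u (tcur t))%R.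

Definition dual_objective (u : 'I_T.+1 -> 'cV[R]_nz)
    (y : 'I_T.+1 -> 'cV[R]_nx) : \bar R :=
  \sum_(t < T.+1)
    ((dotv (z t) (u t))%:E - conjugate (f t) (y t) - conjugate (g t) (u t)).

Definition dual_value : \bar R :=
  ereal_sup [set a | exists u y, dual_constraints u y /\
                                 a = dual_objective u y].

(* R^((T+1)n) is represented by the n x (T+1) matrices, column t being the
   block of time t. *)
Definition stack n (v : 'I_T.+1 -> 'cV[R]_n) : 'M[R]_(n, T.+1) :=
  (\matrix_(i, t) v t i 0)%R.

Definition block_sum n (h : 'I_T.+1 -> 'cV[R]_n -> \bar R)
    (V : 'M[R]_(n, T.+1)) : \bar R :=
  \sum_(t < T.+1) h t (col t V).

Definition strictly_feasible :=
  exists x w, [/\ primal_constraints x w,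
    (ereal_dom (block_sum f))° (stack w) &
    (ereal_dom (block_sum g))° (stack (fun t => z t - H t *m x t)%R)].

End problems.

(* Main.v *)
(* Perturb the constraint v = z - H x to v = z - H x + p. The epigraph of the
   optimal value as a function of p, shifted by the optimal value at p = 0, is
   convex, absorbing in p by strict feasibility, and contains no (0, a) with
   a < 0. A supporting hyperplane at the origin is a Lagrange multiplier u; the
   constraint on y says that <w, y> = <H x, u>, so minimizing the Lagrangian
   separately over each w_t and each v_t gives the conjugates. If the optimal
   value is -oo, weak duality makes every u optimal. *)
Require Import Defs.
From mathcomp Require Import all_boot all_order all_algebra.
From mathcomp Require Import all_classical all_reals all_analysis.
From mathcomp Require Import ring lra.
Set Implicit Arguments.
Unset Strict Implicit.
Unset Printing Implicit Defensive.
Import Order.TTheory GRing.Theory Num.Theory.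
Import numFieldNormedType.Exports.
Local Open Scope classical_set_scope.
Local Open Scope ring_scope.

(** * Supporting hyperplanes at the origin *)

(** A Hahn-Banach extension, one vector of [s] at a time: the head receives as slope the infimum
    [q0] of the heights of [C] over it. Adding to [C] the line through [(e i0, q0)] gives a cone to
    which the induction hypothesis applies. *)
Lemma convex_cone_support (R : realType) (W : lmodType R) (I : eqType)
    (e : I -> W) (s : seq I) (C : W -> R -> Prop) :
  uniq s ->
  (forall d d' r r', C d r -> C d' r' -> C (d + d') (r + r')) ->
  (forall a d r, 0 < a -> C d r -> C (a *: d) (a * r)) ->
  (forall d, exists r, C d r) ->
  (forall r, C 0 r -> 0 <= r) ->
  exists q : I -> R, forall (c : I -> R) r,
    C (\sum_(i <- s) c i *: e i) r -> \sum_(i <- s) c i * q i <= r.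
Proof.
elim: s C => [|i0 s IH] C /=.
  move=> _ _ _ _ C0; exists (fun=> 0) => c r.
  by rewrite !big_nil => /C0.
move=> /andP[i0s us] CD CZ Ctot C0.
pose B : set R := [set r | C (e i0) r].
have [rN CN] := Ctot (- e i0).
have Bn r r' : C (e i0) r -> C (- e i0) r' -> 0 <= r + r'.
  by move=> Cr Cr'; apply: C0; rewrite -(subrr (e i0)); apply: CD.
have Binf : has_inf B.
  split; first by have [r Cr] := Ctot (e i0); exists r.
  by exists (- rN) => r /Bn /(_ CN) h; lra.
pose q0 := inf B.
pose C' d r := exists t, C (d + t *: e i0) (r + t * q0).
have C'1 d r : C d r -> C' d r.
  by move=> Cr; exists 0; rewrite scale0r mul0r !addr0.
have [||||q qP] := IH C' us.
- move=> d d' r r' [t Ct] [t' Ct']; exists (t + t').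
  by rewrite scalerDl mulrDl addrACA (addrACA r); exact: CD.
- move=> a d r a0 [t Ct]; exists (a * t).
  by rewrite -scalerA -scalerDr -mulrA -mulrDr; exact: CZ.
- by move=> d; have [r /C'1 Cr] := Ctot d; exists r.
- move=> r [t]; rewrite add0r => Ct.
  have [t0|t0|t0] := ltgtP t 0; last first.
  + by apply: C0; move: Ct; rewrite t0 scale0r mul0r addr0.
  + have : B (t^-1 * (r + t * q0)).
      rewrite /B /= -[e i0]scale1r -(mulVf (lt0r_neq0 t0)) -scalerA.
      by apply: CZ => //; rewrite invr_gt0.
    move/(ge_inf Binf.2); rewrite -/q0 mulrDr mulKf ?lt0r_neq0//.
    by rewrite lerDr pmulr_rge0 ?invr_gt0.
  (* Scaled by [(- t)^-1], the point lies over [- e i0] at a height below [- q0]. A height over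
     [e i0] close enough to [q0] would then give a negative height over 0. *)
  + rewrite leNgt; apply/negP => r0.
    have Nt0 : 0 < (- t)^-1 by rewrite invr_gt0 oppr_gt0.
    have := CZ _ _ _ Nt0 Ct.
    rewrite scalerA mulrDr mulrA invrN mulNr mulVf ?ltr0_neq0// scaleN1r.
    move=> Cn.
    have e0 : 0 < - (- t^-1 * r).
      by rewrite mulNr opprK nmulr_lgt0 ?invr_lt0.
    have [b Bb bq] := inf_adherent e0 Binf.
    by have := Bn _ _ Bb Cn; rewrite -/q0 in bq *; lra.
exists (fun i => if i == i0 then q0 else q i) => c r.
rewrite !big_cons eqxx => Cr.
have -> : \sum_(j <- s) c j * (if j == i0 then q0 else q j) =
          \sum_(j <- s) c j * q j.
  apply: eq_big_seq => j js; case: eqP => // ji.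
  by move: i0s; rewrite -ji js.
suff : \sum_(j <- s) c j * q j <= r - c i0 * q0 by rewrite lerBrDl.
by apply: qP; exists (c i0); rewrite subrK addrC.
Qed.

(* The cone generated by a convex set replaces a subgradient at the origin of
   the function with epigraph [E]. *)
Lemma convex_epigraph_support (R : realType) (m n : nat)
    (E : 'M[R]_(m, n) -> R -> Prop) :
  (forall P P' a a' l, 0 < l < 1 -> E P a -> E P' a' ->
     E (l *: P + (1 - l) *: P') (l * a + (1 - l) * a')) ->
  (forall P, exists t, 0 < t /\ exists a, E (t *: P) a) ->
  (forall a, E 0 a -> 0 <= a) ->
  exists q : 'M[R]_(m, n), forall P a,
    E P a -> \sum_i \sum_j P i j * q i j <= a.
Proof.
move=> Econv Etot E0.
pose C P a := exists t, 0 < t /\ E (t *: P) (t * a).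
pose e (ij : 'I_m * 'I_n) : 'M[R]_(m, n) := delta_mx ij.1 ij.2.
have [||||q qP] := convex_cone_support (C := C) e
  (index_enum_uniq ('I_m * 'I_n)%type).
- move=> d d' r r' [t [t0 Et]] [t' [t'0 Et']].
  have tt0 : 0 < t + t' by rewrite addr_gt0.
  (* This multiple of [d + d'] is the convex combination of [t *: d] and [t' *: d'] with weights
     [t' / (t + t')] and [t / (t + t')]. *)
  exists (t * t' / (t + t')); split; first by rewrite divr_gt0 ?mulr_gt0.
  have l01 : 0 < t' / (t + t') < 1.
    by rewrite divr_gt0//= ltr_pdivrMr// mul1r ltrDr.
  have := Econv _ _ _ _ _ l01 Et Et'.
  have -> : 1 - t' / (t + t') = t / (t + t') by field; rewrite lt0r_neq0.
  have e1 : t' / (t + t') * t = t * t' / (t + t') by rewrite mulrAC (mulrC t').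
  have e2 : t / (t + t') * t' = t * t' / (t + t') by rewrite mulrAC.
  by rewrite !scalerA !mulrA e1 e2 -scalerDr -mulrDr.
- move=> a d r a0 [t [t0 Et]]; exists (t / a); rewrite divr_gt0//; split=> //.
  by rewrite scalerA mulrA divfK ?lt0r_neq0.
- move=> d; have [t [t0 [a Ea]]] := Etot d; exists (t^-1 * a), t; split=> //.
  by rewrite mulVKf ?lt0r_neq0.
- by move=> r [t [t0]]; rewrite scaler0 => /E0; rewrite pmulr_rge0.
exists (\matrix_(i, j) q (i, j)) => P a EPa.
rewrite pair_bigA/=; under eq_bigr do rewrite mxE.
have := qP (fun ij => P ij.1 ij.2) a.
under eq_bigr do rewrite -surjective_pairing.
apply; exists 1; rewrite scale1r mul1r; split=> //.
suff <- : P = \sum_ij P ij.1 ij.2 *: e ij by [].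
by rewrite {1}[P]matrix_sum_delta pair_bigA.
Qed.

Lemma interior_absorbing (R : realType) (m n : nat) (A : set 'M[R]_(m, n)) V D :
  A° V -> exists t, 0 < t /\ A (V + t *: D).
Proof.
rewrite /interior => /nbhs_ballP[r /= r0 rA].
(* [K] exceeds every [|D i j|], so the step [r / K] moves each entry by less than [r]; balls of
   matrices are entrywise. *)
pose K := 1 + \sum_i \sum_j `|D i j|.
have K0 : 0 < K by rewrite ltr_pwDl// sumr_ge0// => i _; exact: sumr_ge0.
exists (r / K); split; first by rewrite divr_gt0.
apply: rA; split=> // i j; rewrite /ball/= !mxE opprD addNKr normrN normrM.
rewrite gtr0_norm ?divr_gt0// mulrAC ltr_pdivrMr// ltr_pM2l//.
rewrite (@le_lt_trans _ _ (\sum_i \sum_j `|D i j|)) ?ltrDr//.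
rewrite (bigD1 i)//= (bigD1 j)//= -addrA lerDl.
by apply: addr_ge0; apply: sumr_ge0 => // k _; exact: sumr_ge0.
Qed.

(** * Suprema and sums of extended reals *)

Section ereal_sup_sum.
Local Open Scope ereal_scope.
Context {R : realType}.
Implicit Types A B : set (\bar R).

(** The finite members keep the right-hand side [c] above -oo. If [c] is +oo the bound is trivial;
    otherwise [c] is real and can be shifted across the inequality, once for each supremum. *)
Lemma le_ereal_supD A B :
  (exists2 a, A a & a \is a fin_num) -> (exists2 b, B b & b \is a fin_num) ->
  ereal_sup A + ereal_sup B <= ereal_sup [set a + b | a in A & b in B].
Proof.
move=> [a0 Aa0 fa0] [b0 Bb0 fb0].
set c := (X in _ <= X).
have ub a b : A a -> B b -> a + b <= c.
  by move=> Aa Bb; apply: ereal_sup_ubound; exists a => //; exists b.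
have [->|cy] := eqVneq c +oo; first by rewrite leey.
have fc : c \is a fin_num.
  have := ub _ _ Aa0 Bb0.
  by move: fa0 fb0 cy; move: c a0 b0 {ub Aa0 Bb0} => [?| |] [?| |] [?| |].
have fA : ereal_sup A \is a fin_num.
  have : ereal_sup A <= c - b0.
    by apply: ge_ereal_sup => a Aa; rewrite leeBrDr//; exact: ub.
  have := ereal_sup_ubound Aa0.
  move: (ereal_sup A) fa0 fb0 fc.
  by move: c a0 b0 {ub Aa0 Bb0 cy} => [?| |] [?| |] [?| |] // [?| |].
rewrite addeC -leeBrDr//; apply: ge_ereal_sup => b Bb.
rewrite leeBrDr// addeC.
case: b Bb => [b||] Bb; last by rewrite addeNy leNye.
  rewrite -leeBrDr//; apply: ge_ereal_sup => a Aa.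
  by rewrite leeBrDr//; exact: ub.
have := ub _ _ Aa0 Bb; move: fa0 fc.
by move: c a0 {ub Aa0 cy} => [?| |] [?| |].
Qed.

Lemma sum_selection_fin_num n (A : 'I_n -> set (\bar R)) :
  (forall i, exists2 a, A i a & a \is a fin_num) ->
  exists2 s, [set \sum_(i < n) a i | a in [set a | forall i, A i (a i)]] s &
             s \is a fin_num.
Proof.
move=> A_fin; have /choice[a aP] : forall i, exists a, A i a /\ a \is a fin_num.
  by move=> i; have [a] := A_fin i; exists a.
exists (\sum_(i < n) a i); first by exists a => // i; case: (aP i).
by apply/sum_fin_numP => i _ _; case: (aP i).
Qed.

(** The members can be selected independently of each other. This is what lets a sum of conjugates
    be bounded through one joint choice of all blocks. *)
Lemma le_sum_ereal_sup n (A : 'I_n -> set (\bar R)) :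
  (forall i, exists2 a, A i a & a \is a fin_num) ->
  \sum_(i < n) ereal_sup (A i) <=
  ereal_sup [set \sum_(i < n) a i | a in [set a | forall i, A i (a i)]].
Proof.
elim: n A => [|n IH] A fA.
  rewrite big_ord0; apply: ereal_sup_ubound.
  by exists (fun=> 0) => [[]|]//; rewrite big_ord0.
rewrite big_ord_recl.
apply: (le_trans (leeD2l _ (IH (fun i => A (lift ord0 i)) (fun i => fA _)))).
apply: le_trans (le_ereal_supD (fA ord0) _) _.
  exact: (sum_selection_fin_num (fun i => fA (lift ord0 i))).
apply: ereal_sup_le => _ [a0 Aa0 [_ [a Aa] <-] <-].
(* The selection for the tail is extended by [a0] at index 0. *)
exists (fun i => if unlift ord0 i is Some j then a j else a0) => [i|].
  by case: unliftP => [j ->|->].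
by rewrite big_ord_recl unlift_none; under [in LHS]eq_bigr do rewrite liftK.
Qed.

End ereal_sup_sum.

Section sum_above_ninfty.
Local Open Scope ereal_scope.
Context {R : realDomainType} (n : nat).
Implicit Types a b : 'I_n -> \bar R.

Lemma lt_ninfty_sum b : (forall i, -oo < b i) -> -oo < \sum_i b i.
Proof.
move=> b_gt; rewrite ltNye; apply/eqP => /esum_eqNyP[i [_ _ bi]].
by have := b_gt i; rewrite bi.
Qed.

(** With no [b i] equal to -oo, negating the sum meets no clash of infinities. *)
Lemma sumeB_ninfty a b : (forall i, -oo < b i) ->
  \sum_i (a i - b i) = \sum_i a i - \sum_i b i.
Proof.
move=> b_gt; rewrite big_split/= sumeN// => i j _ _.
by move: (b_gt i) (b_gt j); case: (b i) => [?| |]; case: (b j) => [?| |].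
Qed.

Lemma sum_pinfty_or_fin_num b : (forall i, -oo < b i) ->
  \sum_i b i = +oo \/ forall i, b i \is a fin_num.
Proof.
move=> b_gt; have [->|sy] := eqVneq (\sum_i b i) +oo; first by left.
right=> i.
have bN j : b j != -oo by rewrite -ltNye.
rewrite fin_numE bN/=; apply: contra_neq sy => bi.
by apply/esum_eqyP => //; exists i; rewrite mem_index_enum.
Qed.

End sum_above_ninfty.

(** * Inner products and the two systems of constraints *)

Section dot_product.
Context {R : realType}.

Lemma dotvE n (x y : 'cV[R]_n) : dotv x y = \sum_i x i 0 * y i 0.
Proof. by rewrite /dotv mxE; apply: eq_bigr => i _; rewrite mxE. Qed.

Lemma dotvC n (x y : 'cV[R]_n) : dotv x y = dotv y x.
Proof. by rewrite !dotvE; apply: eq_bigr => i _; rewrite mulrC. Qed.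

Lemma dotvDl n (x y z : 'cV[R]_n) : dotv (x + y) z = dotv x z + dotv y z.
Proof. by rewrite /dotv linearD mulmxDl mxE. Qed.

Lemma dotvNl n (x z : 'cV[R]_n) : dotv (- x) z = - dotv x z.
Proof. by rewrite /dotv linearN mulNmx mxE. Qed.

Lemma dotvBl n (x y z : 'cV[R]_n) : dotv (x - y) z = dotv x z - dotv y z.
Proof. by rewrite dotvDl dotvNl. Qed.

Lemma dotv_adjoint m n (A : 'M[R]_(m, n)) x y :
  dotv (A *m x) y = dotv x (A^T *m y).
Proof. by rewrite /dotv trmx_mul mulmxA. Qed.

End dot_product.

Section constraints.
Context (R : realType) (nx nz T : nat) (F : 'I_T -> 'M[R]_nx)
  (H : 'I_T.+1 -> 'M[R]_(nz, nx)).

Lemma primal_constraints_solvable w : exists x, primal_constraints F x w.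
Proof.
(* The recursion runs over [nat]; for the indices up to [T] that are read, [insub] succeeds and the
   default 0 does not occur. *)
pose fix X k : 'cV[R]_nx := if k is k'.+1 then
    if (insub k' : option 'I_T) is Some t then F t *m X k' + w (tnext t) else 0
  else w ord0.
exists (fun t => X t); split=> // t.
have -> : X (tnext t) = X t.+1 by [].
by rewrite /= valK.
Qed.

Lemma dual_constraints_solvable u : exists y, dual_constraints F H u y.
Proof.
(* [Y k] is the value at time [T - k], since the dual recursion runs backwards; [insub] succeeds for
   every [k] from 1 to [T]. *)
pose fix Y k : 'cV[R]_nx := if k is k'.+1 then
    if (insub (T - k'.+1)%N : option 'I_T) is Some t
    then (F t)^T *m Y k' + (H (tcur t))^T *m u (tcur t) else 0
  else (H ord_max)^T *m u ord_max.
exists (fun t => Y (T - t)%N); split=> [|t]; first by rewrite /= subnn.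
have -> : Y (T - tnext t)%N = Y (T - t.+1)%N by [].
have -> : Y (T - tcur t)%N = Y (T - t.+1).+1 by rewrite subnSK.
rewrite /= subnSK// subKn ?(ltnW (ltn_ord t))//.
by rewrite valK.
Qed.

(** Summation by parts: the dual dynamics are the transpose of the primal ones, so the terms
    [dotv (x t) (y t)] telescope and only those with [u] remain. *)
Lemma primal_dual_adjoint x w u y :
  primal_constraints F x w -> dual_constraints F H u y ->
  \sum_t dotv (w t) (y t) = \sum_t dotv (H t *m x t) (u t).
Proof.
move=> [x0 xS] [yT yS]; rewrite big_ord_recl -x0.
have wE t : dotv (w (lift ord0 t)) (y (lift ord0 t)) =
    dotv (x (tnext t)) (y (tnext t)) -
    (dotv (x (tcur t)) (y (tcur t)) -
     dotv (H (tcur t) *m x (tcur t)) (u (tcur t))).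
  rewrite yS xS dotvDl !dotv_adjoint.
  by rewrite (dotvC (x (tcur t)) (_ + _)) dotvDl !(dotvC _ (x (tcur t))); ring.
under eq_bigr do rewrite wE.
(* The initial term completes the sum over the later times to one over 0..T. Subtracting the sum
   over 0..T-1 leaves the term at T, where [y] is given by [u]. *)
rewrite sumrB addrA -(big_ord_recl _ (fun t => dotv (x t) (y t))).
rewrite sumrB [X in X - _]big_ord_recr [RHS]big_ord_recr/=.
by rewrite yT !dotv_adjoint /tcur; ring.
Qed.

End constraints.

(** * Weak duality, the multiplier and its dual value *)

Section duality.
Local Open Scope ereal_scope.
Context (R : realType) (nx nz T : nat)
  (f : 'I_T.+1 -> 'cV[R]_nx -> \bar R) (g : 'I_T.+1 -> 'cV[R]_nz -> \bar R)
  (F : 'I_T -> 'M[R]_nx) (H : 'I_T.+1 -> 'M[R]_(nz, nx))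
  (z : 'I_T.+1 -> 'cV[R]_nz).

Lemma fenchel_young n (h : 'cV[R]_n -> \bar R) x y :
  (dotv x y)%:E - h x <= conjugate h y.
Proof. by apply: ereal_sup_ubound; exists x. Qed.

Lemma conjugate_gt_ninfty n (h : 'cV[R]_n -> \bar R) x y :
  h x \is a fin_num -> -oo < conjugate h y.
Proof.
move=> hx; apply: lt_le_trans (fenchel_young h x y).
by rewrite -(fineK hx) -EFinB ltNyr.
Qed.

Lemma block_sum_stack n (h : 'I_T.+1 -> 'cV[R]_n -> \bar R) v :
  block_sum h (stack v) = \sum_t h t (v t).
Proof.
apply: eq_bigr => t _; congr (h t _).
by apply/matrixP => i j; rewrite !mxE (ord1 j).
Qed.

Lemma weak_duality u y :
  (forall t x, -oo < f t x) -> (forall t x, -oo < g t x) ->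
  dual_constraints F H u y ->
  dual_objective f g z u y <= primal_value f g F H z.
Proof.
move=> f_gt g_gt yP; apply: le_ereal_inf_tmp => _ [x [w [xP ->]]].
rewrite /primal_objective -big_split/=.
set v := fun t => (z t - H t *m x t)%R.
(* Fenchel-Young for [f t] and [g t] bounds the dual term by the primal term plus [d t]; the adjoint
   identity makes the [d t] sum to 0. *)
pose d t := (dotv (z t) (u t) - dotv (w t) (y t) - dotv (v t) (u t))%R.
have d0 : (\sum_t d t = 0)%R.
  rewrite /d /v; under eq_bigr do rewrite dotvBl.
  by rewrite !sumrB (primal_dual_adjoint xP yP); ring.
rewrite -[leRHS]add0e -[X in X + _]/(0%:E) -d0 -sumEFin -big_split/=.
apply: lee_sum => t _.
have := fenchel_young (f t) (w t) (y t).
have := fenchel_young (g t) (v t) (u t).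
move: (f_gt t (w t)) (g_gt t (v t)); rewrite -/(v t) /d.
case: (f t (w t)) => [a||]//; case: (g t (v t)) => [b||]// _ _; last 3 first.
- by move=> _ _; rewrite leey.
- by move=> _ _; rewrite leey.
- by move=> _ _; rewrite leey.
case: (conjugate _ _) => [a'||]//; case: (conjugate _ _) => [b'||]//=;
  by rewrite ?lee_fin ?leNye//; lra.
Qed.

(* [u] is a Lagrange multiplier for the constraint [v = z - H x], obtained by
   perturbing that constraint by the columns of a matrix [P]. *)
Lemma lagrange_multiplier p :
  (forall t x, -oo < f t x) -> (forall t x, -oo < g t x) ->
  (forall t, ereal_convex (f t)) -> (forall t, ereal_convex (g t)) ->
  strictly_feasible f g F H z -> primal_value f g F H z = p%:E ->
  exists u : 'I_T.+1 -> 'cV[R]_nz, forall x w v, primal_constraints F x w ->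
    (p + \sum_t dotv (v t - z t + H t *m x t) (u t))%:E <=
    \sum_t f t (w t) + \sum_t g t (v t).
Proof.
move=> f_gt g_gt f_conv g_conv [x0 [w0 [xP0 fi gi]]] pE.
(* Real upper bounds [phi] and [gam] stand for the values of [f] and [g], which keeps the shifted
   epigraph in the reals. *)
pose E (P : 'M[R]_(nz, T.+1)) (a : R) := exists x w (phi gam : 'I_T.+1 -> R),
  [/\ primal_constraints F x w, forall t, f t (w t) <= (phi t)%:E,
      forall t, g t (z t - H t *m x t + col t P)%R <= (gam t)%:E &
      a = (\sum_t phi t + \sum_t gam t - p)%R].
have [|||q qP] := @convex_epigraph_support R nz T.+1 E.
- move=> P P' a a' l l01 [x [w [phi [gam [xP fP gP aE]]]]].
  move=> [x' [w' [phi' [gam' [xP' fP' gP' aE']]]]].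
  have [l0 l1] : (0 <= l /\ 0 <= 1 - l)%R by move/andP: l01; lra.
  have comb m (h : 'cV[R]_m -> \bar R) (v v' : 'cV[R]_m) b b' :
      ereal_convex h -> h v <= b%:E -> h v' <= b'%:E ->
      h (l *: v + (1 - l) *: v')%R <= (l * b + (1 - l) * b')%:E.
    move=> h_conv hb hb'; apply: (le_trans (h_conv _ _ _ l01)).
    by rewrite [leRHS]EFinD !EFinM; apply: leeD; apply: lee_wpmul2l.
  exists (fun t => l *: x t + (1 - l) *: x' t)%R.
  exists (fun t => l *: w t + (1 - l) *: w' t)%R.
  exists (fun t => l * phi t + (1 - l) * phi' t)%R.
  exists (fun t => l * gam t + (1 - l) * gam' t)%R; split=> [|t|t|].
  + case: xP xP' => [xw xS] [xw' xS']; split=> [|t]; first by rewrite xw xw'.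
    rewrite xS xS' !scalerDr mulmxDr -!scalemxAr.
    by rewrite addrACA.
  + exact: comb.
  + have -> : (z t - H t *m (l *: x t + (1 - l) *: x' t) +
        col t (l *: P + (1 - l) *: P') =
        l *: (z t - H t *m x t + col t P) +
        (1 - l) *: (z t - H t *m x' t + col t P'))%R.
      rewrite mulmxDr -!scalemxAr.
      by apply/matrixP => i j; rewrite !mxE; ring.
    exact: comb.
  + by rewrite aE aE' !big_split/= -!mulr_sumr; ring.
(* The strictly feasible trajectory is kept fixed; only the argument of [g] moves, and it stays in
   the domain for a small step [s]. *)
- move=> P; have [s [s0 sP]] := interior_absorbing P gi.
  exists s; split=> //.
  have fP := interior_subset fi.
  exists (\sum_t fine (f t (w0 t)) + \sum_t
    fine (g t (z t - H t *m x0 t + col t (s *: P))%R) - p)%R.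
  exists x0, w0, (fun t => fine (f t (w0 t))),
    (fun t => fine (g t (z t - H t *m x0 t + col t (s *: P))%R)).
  split=> // t; rewrite fineK//.
  + have := sum_fin_numP _ _ _ fP t (mem_index_enum t) isT.
    congr (_ \is a fin_num); congr (f t _).
    by apply/matrixP => i j; rewrite !mxE (ord1 j).
  + have := sum_fin_numP _ _ _ sP t (mem_index_enum t) isT.
    congr (_ \is a fin_num); congr (g t _).
    by apply/matrixP => i j; rewrite !mxE (ord1 j).
- move=> a [x [w [phi [gam [xP fP gP ->]]]]]; rewrite subr_ge0 -lee_fin -pE.
  apply: (@le_trans _ _ (primal_objective f g H z x w)).
    by apply: ereal_inf_lbound; exists x, w.
  rewrite EFinD -!sumEFin; apply: leeD; apply: lee_sum => t _ //.
  by have := gP t; rewrite linear0 addr0.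
exists (fun t => col t q) => x w v xP.
have [->|ff] := sum_pinfty_or_fin_num (fun t => f_gt t (w t)).
  by rewrite addye ?leey// -ltNye lt_ninfty_sum.
have [->|gf] := sum_pinfty_or_fin_num (fun t => g_gt t (v t)).
  by rewrite addey ?leey// -ltNye lt_ninfty_sum.
under [X in _ <= X + _]eq_bigr do rewrite -(fineK (ff _)).
under [X in _ <= _ + X]eq_bigr do rewrite -(fineK (gf _)).
rewrite !sumEFin -EFinD lee_fin addrC -lerBrDr.
(* The perturbation under which the given [v] satisfies the constraint for [x]. *)
pose P := (\matrix_(i, t) (v t - z t + H t *m x t) i 0)%R.
have EP : E P (\sum_t fine (f t (w t)) + \sum_t fine (g t (v t)) - p)%R.
  exists x, w, (fun t => fine (f t (w t))), (fun t => fine (g t (v t))).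
  split=> // t; rewrite fineK//.
  rewrite (_ : _ + _ = v t)%R//.
  by apply/matrixP => i j; rewrite !mxE (ord1 j); ring.
apply: le_trans (qP _ _ EP); rewrite exchange_big/=.
by apply: ler_sum => t _; rewrite dotvE; apply: ler_sum => i _; rewrite !mxE.
Qed.

(** Here [w] and [v] range freely, and the adjoint identity replaces the terms in [H t *m x t] by
    [dotv (w t) (y t)]. The hypothesis then bounds a sum of separate functions of the blocks, whose
    supremum is the sum of the conjugates. *)
Lemma dual_optimal p u y :
  (forall t x, -oo < f t x) -> (forall t x, -oo < g t x) ->
  (forall t, exists x, f t x \is a fin_num) ->
  (forall t, exists x, g t x \is a fin_num) ->
  dual_constraints F H u y ->
  (forall x w v, primal_constraints F x w ->
    (p + \sum_t dotv (v t - z t + H t *m x t) (u t))%:E <=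
    \sum_t f t (w t) + \sum_t g t (v t)) ->
  p%:E <= dual_objective f g z u y.
Proof.
move=> f_gt g_gt f_fin g_fin yP pP.
have cf t : -oo < conjugate (f t) (y t).
  by have [x /(@conjugate_gt_ninfty _ _ _ (y t))] := f_fin t.
have cg t : -oo < conjugate (g t) (u t).
  by have [x /(@conjugate_gt_ninfty _ _ _ (u t))] := g_fin t.
rewrite /dual_objective !sumeB_ninfty// sumEFin.
suff : \sum_t conjugate (f t) (y t) + \sum_t conjugate (g t) (u t) <=
    (\sum_t dotv (z t) (u t) - p)%:E.
  move: (lt_ninfty_sum cf) (lt_ninfty_sum cg).
  case: (\sum_t conjugate _ _) => [a||]//;
    case: (\sum_t conjugate _ _) => [b||]//.
  by rewrite !lee_fin; lra.
have finP n (h : 'I_T.+1 -> 'cV[R]_n -> \bar R) v :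
    (forall t, exists x, h t x \is a fin_num) -> forall t, exists2 a,
    [set (dotv x (v t))%:E - h t x | x in [set: 'cV[R]_n]] a & a \is a fin_num.
  move=> h_fin t; have [x hx] := h_fin t.
  by exists ((dotv x (v t))%:E - h t x); [exists x | rewrite fin_numB hx].
have fS := finP _ _ y f_fin; have gS := finP _ _ u g_fin.
apply: le_trans (leeD (le_sum_ereal_sup fS) (le_sum_ereal_sup gS)) _.
have fgS := le_ereal_supD (sum_selection_fin_num fS) (sum_selection_fin_num gS).
apply: le_trans fgS _.
apply: ge_ereal_sup => _ [_ [a aP <-] [_ [b bP <-] <-]].
(* The selected values are realized by blocks [w] and [v]; a trajectory [x] driven by [w] makes the
   multiplier inequality applicable. *)
have /choice[w wP] : forall t, exists x, (dotv x (y t))%:E - f t x = a t.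
  by move=> t; have [x _ <-] := aP t; exists x.
have /choice[v vP] : forall t, exists x, (dotv x (u t))%:E - g t x = b t.
  by move=> t; have [x _ <-] := bP t; exists x.
have [x xP] := primal_constraints_solvable F w.
have := pP x w v xP.
under eq_bigr do rewrite dotvDl dotvBl.
rewrite big_split/= sumrB -(primal_dual_adjoint xP yP).
under [in X in _ -> X]eq_bigr do rewrite -wP.
under [X in _ -> _ + X <= _]eq_bigr do rewrite -vP.
rewrite !sumeB_ninfty// !sumEFin.
move: (lt_ninfty_sum (fun t => f_gt t (w t))).
move: (lt_ninfty_sum (fun t => g_gt t (v t))).
case: (\sum_t f _ _) => [r||]//; case: (\sum_t g _ _) => [r'||]//= _ _.
all: by rewrite ?lee_fin ?leNye//; lra.
Qed.

End duality.

Theorem theorem2p6 (R : realType) (nx nz T : nat)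
    (f : 'I_T.+1 -> 'cV[R]_nx -> \bar R)
    (g : 'I_T.+1 -> 'cV[R]_nz -> \bar R)
    (F : 'I_T -> 'M[R]_nx) (H : 'I_T.+1 -> 'M[R]_(nz, nx))
    (z : 'I_T.+1 -> 'cV[R]_nz)
    (f_logconcave : forall t, logconcave_density_potential (f t))
    (g_logconcave : forall t, logconcave_density_potential (g t))
    (strict_feasibility : strictly_feasible f g F H z) :
  dual_value f g F H z = primal_value f g F H z /\
  exists u y, dual_constraints F H u y /\
    dual_objective f g z u y = dual_value f g F H z.
Proof.
have f_gt t x : (-oo < f t x)%E by case: (f_logconcave t).
have g_gt t x : (-oo < g t x)%E by case: (g_logconcave t).
have wd u y := @weak_duality _ _ _ _ f g F H z u y f_gt g_gt.
have dual_le : (dual_value f g F H z <= primal_value f g F H z)%E.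
  by apply: ge_ereal_sup => _ [u [y [yP ->]]]; exact: wd.
(* By weak duality, one dual point reaching the primal value gives both the equality and the
   attainment. *)
suff [u [y [yP uyP]]] : exists u y, dual_constraints F H u y /\
    (primal_value f g F H z <= dual_objective f g z u y)%E.
  have dual_ge : (dual_objective f g z u y <= dual_value f g F H z)%E.
    by apply: ereal_sup_ubound; exists u, y.
  have E : dual_value f g F H z = primal_value f g F H z.
    by apply: le_anti; rewrite dual_le (le_trans uyP).
  split=> //; exists u, y; split=> //.
  by apply: le_anti; rewrite dual_ge E.
have [x0 [w0 [xP0 fi gi]]] := strict_feasibility.
move: fi gi => /interior_subset fi /interior_subset gi.
have {fi} fF : (\sum_t f t (w0 t))%E \is a fin_num by rewrite -block_sum_stack.
have {gi} gF : (\sum_t g t (z t - H t *m x0 t)%R)%E \is a fin_num.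
  by rewrite -(block_sum_stack g (fun t => z t - H t *m x0 t)).
(* A real value yields a multiplier; +oo contradicts the finite cost of the strictly feasible point;
   for -oo the zero control serves. *)
case pE : (primal_value f g F H z) => [p||].
- have [||u uP] := lagrange_multiplier f_gt g_gt _ _ strict_feasibility pE.
  + by move=> t; case: (f_logconcave t).
  + by move=> t; case: (g_logconcave t).
  have [y yP] := dual_constraints_solvable F H u.
  exists u, y; split=> //; apply: (dual_optimal f_gt g_gt _ _ yP uP) => t.
  + by exists (w0 t); exact: (sum_fin_numP _ _ _ fF t (mem_index_enum t) isT).
  + by exists (z t - H t *m x0 t);
      exact: (sum_fin_numP _ _ _ gF t (mem_index_enum t) isT).
- have : (primal_value f g F H z <= primal_objective f g H z x0 w0)%E.
    by apply: ereal_inf_lbound; exists x0, w0.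
  have obj_fin : primal_objective f g H z x0 w0 \is a fin_num.
    by rewrite fin_numD fF gF.
  by rewrite pE leye_eq => /eqP obj; rewrite obj in obj_fin.
- have [y yP] := dual_constraints_solvable F H (fun=> 0).
  by exists (fun=> 0), y; rewrite leNye.
Qed.
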